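(* Let $A\in\mathbb{R}^{n\times n}$ be a nonsingular matrix and $1\leq k\leq d(A)-1$. Then $$\varphi_{k,\mathbb{R},\mathbb{R}}(A)=\varphi_{k,\mathbb{C},\mathbb{R}}(A)=\varphi_{k,\mathbb{R},\mathbb{C}}(A)=\varphi_{k,\mathbb{C},\mathbb{C}}(A).$$
   Context: $\|\cdot\|$ is the Euclidean norm and $d(A)$ is the degree of the minimal polynomial of $A$. For $\mathbb{K},\mathbb{F}\in\{\mathbb{R},\mathbb{C}\}$, $\pi_{k,\mathbb{K}}$ denotes the set of polynomials $p$ with coefficients in $\mathbb{K}$, of degree at most $k$, with $p(0)=1$, and $$\varphi_{k,\mathbb{K},\mathbb{F}}(A)=\min_{p\in\pi_{k,\mathbb{K}}}\ \max_{b\in\mathbb{F}^{n},\ \|b\|=1}\|p(A)b\|.$$ *)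

(* Defs.v *)
From HB Require Import structures.
From mathcomp Require Import all_boot all_order all_algebra.
From mathcomp Require Import all_classical all_reals all_analysis.
From mathcomp Require Import complex.

Set Implicit Arguments.
Unset Strict Implicit.
Unset Printing Implicit Defensive.

Import Order.TTheory GRing.Theory Num.Theory.
Import numFieldNormedType.Exports.
Import ComplexField.Normc.

Local Open Scope classical_set_scope.
Local Open Scope ring_scope.
Local Open Scope complex_scope.

(* R and C are both given as predicates on R[i], so that polynomials over K and
   vectors over F have one type: [Num.real] selects the real numbers (those with
   zero imaginary part, see [complex_realP]) and [predT] all complex numbers. *)

Definition enorm (R : realType) (n : nat) (v : 'cV[R[i]]_n) : R :=
  Num.sqrt (\sum_i normc (v i 0) ^+ 2).

Definition unit_vectors (R : realType) (F : {pred R[i]}) (n : nat) :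
    set 'cV[R[i]]_n :=
  [set b | b \is a mxOver F /\ enorm b = 1].
Arguments unit_vectors {R} F {n} _.

Definition normalized_polys (R : realType) (K : {pred R[i]}) (k : nat) :
    set {poly R[i]} :=
  [set p | [/\ p \is a polyOver K, (size p <= k.+1)%N & p.[0] = 1]].

(* The supremum is a maximum, see [max_normP]. *)
Definition max_norm (R : realType) (n : nat) (F : {pred R[i]})
    (M : 'M[R[i]]_n) : R :=
  sup [set enorm (M *m b) | b in unit_vectors F].

(* The infimum is a minimum, see [phiP]. *)
Definition phi (R : realType) (n k : nat) (K F : {pred R[i]})
    (A : 'M[R]_n.+1) : R :=
  inf [set max_norm F (horner_mx (map_mx (real_complex R) A) p)
      | p in normalized_polys K k].

Section attainment.
Variable R : realType.
Local Notation C := R[i].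

Let normc_ge0 (x : C) : 0 <= normc x.
Proof. by case: x => a b; exact: sqrtr_ge0. Qed.

Let normc_sqr (x : C) : normc x ^+ 2 = complex.Re x ^+ 2 + complex.Im x ^+ 2.
Proof. by case: x => a b; rewrite /= sqr_sqrtr ?addr_ge0 ?sqr_ge0. Qed.

Let Re_le_normc (x : C) : `|complex.Re x| <= normc x.
Proof.
by rewrite -(ger0_norm (normc_ge0 x)) -ler_sqr ?nnegrE // !real_normK ?num_real //
  normc_sqr lerDl sqr_ge0.
Qed.

Let Im_le_normc (x : C) : `|complex.Im x| <= normc x.
Proof.
by rewrite -(ger0_norm (normc_ge0 x)) -ler_sqr ?nnegrE // !real_normK ?num_real //
  normc_sqr lerDr sqr_ge0.
Qed.

Let normc_le_enorm n (v : 'cV[C]_n) i : normc (v i 0) <= enorm v.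
Proof.
rewrite -(ger0_norm (normc_ge0 _)) -sqrtr_sqr /enorm ler_sqrt ?sqr_ge0 //.
  by rewrite (bigD1 i) //= lerDl sumr_ge0 // => *; exact: sqr_ge0.
by apply: sumr_ge0 => *; exact: sqr_ge0.
Qed.

Let sum_cont (T : topologicalType) (I : finType) (f : I -> T -> R) :
  (forall i, continuous (f i)) -> continuous (fun x => \sum_i f i x).
Proof.
move=> fc; elim: (index_enum I) => [|i s IH] x.
  by under eq_fun do rewrite big_nil; exact: cvg_cst.
under eq_fun do rewrite big_cons.
by apply: cvgD; [exact: fc|exact: IH].
Qed.

Let linear_cont m (f : 'rV[R]_m -> R) :
  (forall a u v, f (a *: u + v) = a * f u + f v) -> continuous f.
Proof.
move=> fl.
have f0 : f 0 = 0.
  have := fl 1 0 0; rewrite scaler0 addr0 mul1r.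
  by move/eqP; rewrite -subr_eq subrr eq_sym => /eqP.
have fE w : f w = \sum_j w 0 j * f (delta_mx 0 j).
  rewrite [in LHS](row_sum_delta w).
  have : forall s : seq 'I_m, f (\sum_(j <- s) w 0 j *: delta_mx 0 j) =
      \sum_(j <- s) w 0 j * f (delta_mx 0 j).
    elim=> [|j s IH]; first by rewrite !big_nil.
    by rewrite !big_cons fl IH.
  exact.
rewrite (_ : f = fun w => \sum_j w 0 j * f (delta_mx 0 j)); last exact/funext.
apply: sum_cont => j w.
by apply: continuousM; [exact: coord_continuous|exact: cst_continuous].
Qed.

Let enorm_cont m n (L : 'rV[R]_m -> 'cV[C]_n) :
  (forall a u v, L (a *: u + v) = a%:C *: L u + L v) ->
  continuous (fun w => enorm (L w)).
Proof.
move=> Ll w; apply: (@continuous_comp _ _ _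
  (fun w => \sum_i normc (L w i 0) ^+ 2) (@Num.sqrt R)); last exact: sqrt_continuous.
move: w; apply: sum_cont => i.
have cRe : continuous (fun w => complex.Re (L w i 0)).
  apply: linear_cont => a u v; rewrite Ll !mxE.
  by case: (L u i 0) (L v i 0) => [x y] [x' y'] /=; rewrite mul0r subr0.
have cIm : continuous (fun w => complex.Im (L w i 0)).
  apply: linear_cont => a u v; rewrite Ll !mxE.
  by case: (L u i 0) (L v i 0) => [x y] [x' y'] /=; rewrite mul0r addr0.
rewrite (_ : (fun w => _) = fun w => complex.Re (L w i 0) * complex.Re (L w i 0) +
  complex.Im (L w i 0) * complex.Im (L w i 0)); last first.
  by apply/funext => w; rewrite normc_sqr !expr2.
move=> w; exact: (cvgD (continuousM (cRe w) (cRe w)) (continuousM (cIm w) (cIm w))).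
Qed.

Let bounded_rV m (D : set 'rV[R]_m) (r : R) :
  (forall w, D w -> forall j, `|w 0 j| <= r) -> bounded_set D.
Proof.
move=> Dr; exists (Num.max r 0); split; first exact: num_real.
move=> x /ltW rx w Dw.
rewrite /= [leLHS]mx_normrE; apply/bigmax_leP; split.
  by apply: le_trans rx; rewrite le_max lexx orbT.
move=> [i j] _ /=; rewrite ord1; apply: le_trans (Dr _ Dw j) _.
by apply: le_trans rx; rewrite le_max lexx.
Qed.

Let compact_argmin (T : topologicalType) (I : Type) (J : set I)
    (h : I -> T -> R) (g : T -> R) (D : set T) :
  compact D -> D !=set0 -> (forall i, J i -> continuous (h i)) ->
  (forall x r, D x -> (g x <= r <-> (forall i, J i -> h i x <= r))) ->
  exists2 c, D c & forall x, D x -> g c <= g x.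
Proof.
move=> Dc [x0 Dx0] hc gE.
pose B x := [set y | D y /\ g y <= g x].
have FB : ProperFilter (filter_from D B).
  apply: filter_from_proper; last by move=> x Dx; exists x.
  apply: filter_from_filter; first by exists x0.
  move=> x y Dx Dy; case: (leP (g x) (g y)) => [xy|/ltW yx].
    by exists x => // z [Dz zx]; split; split=> //; exact: le_trans xy.
  by exists y => // z [Dz zx]; split; split=> //; exact: le_trans yx.
have [|c [Dc' cl]] := Dc _ FB; first by exists x0 => // z [].
exists c => // x Dx; apply/gE => // i Ji.
have cBx : closed [set y | h i y <= g x].
  apply: (@preimage_closed _ _ (h i) [set y | y <= g x]); last exact: closed_le.
  by move=> ? _; exact: hc.
apply: cBx => V Vc; apply: (cl _ _ _ Vc).
by exists x => // y [Dy yx] /=; apply: (gE y (g x) Dy).1.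
Qed.

Let emb m (w : 'rV[R]_(m + m)) : 'cV[C]_m :=
  \col_j (w 0 (lshift m j) +i* w 0 (rshift m j)).

Let embP m a (u v : 'rV[R]_(m + m)) : emb (a *: u + v) = a%:C *: emb u + emb v.
Proof.
by apply/colP => j; rewrite !mxE /=; apply/eqP;
  rewrite eq_complex /= !mul0r subr0 addr0 !eqxx.
Qed.

Let emb_surj m (b : 'cV[C]_m) : exists w, emb w = b.
Proof.
exists (row_mx (\row_j complex.Re (b j 0)) (\row_j complex.Im (b j 0))).
apply/colP => j; rewrite !mxE (unsplitK (inl _)) (unsplitK (inr _)) !mxE.
by case: (b j 0).
Qed.

Let emb_bound m (w : 'rV[R]_(m + m)) r :
  (forall j, normc (emb w j 0) <= r) -> forall j, `|w 0 j| <= r.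
Proof.
move=> wr j; rewrite -(fintype.splitK j); case: (fintype.split j) => j' /=.
  by apply: le_trans (wr j'); apply: le_trans (Re_le_normc _); rewrite !mxE.
by apply: le_trans (wr j'); apply: le_trans (Im_le_normc _); rewrite !mxE.
Qed.

Let is_field (K : {pred C}) := K = Num.real \/ K = predT.

Let field01 K : is_field K -> 0 \in K /\ 1 \in K.
Proof. by case=> ->; split=> //; rewrite ?real0 ?real1. Qed.

Let polyOverE K (p : {poly C}) : is_field K ->
  p \is a polyOver K <-> forall i, p`_i \in K.
Proof.
move=> hK; have [K0 _] := field01 hK; split=> [/allP pK i|pK].
  case: (ltnP i (size p)) => ip; first exact/pK/mem_nth.
  by rewrite nth_default.
by apply/allP => _ /(nthP 0)[i _ <-]; exact: pK.
Qed.

Let closed_over m K : is_field K ->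
  closed [set w : 'rV[R]_(m + m) | emb w \is a mxOver K].
Proof.
case=> ->; last first.
  rewrite (_ : mkset _ = setT); first exact: closedT.
  by rewrite -subTset => w _; apply/mxOverP.
rewrite (_ : mkset _ = \bigcap_(j in [set: 'I_m])
   (fun w : 'rV[R]_(m + m) => w 0 (rshift m j)) @^-1` [set x : R | x = 0]).
  apply: closed_bigI => j _; apply: preimage_closed; last exact: closed_eq.
  by move=> ? _; exact: coord_continuous.
apply/seteqP; split=> w /=.
  by move/mxOverP => wR j _; have := wR j 0; rewrite mxE complex_real => /eqP.
by move=> wR; apply/mxOverP => j j0; rewrite mxE complex_real wR.
Qed.

Let delta_unit m F (j : 'I_m) : is_field F ->
  unit_vectors F (delta_mx j 0 : 'cV[C]_m).
Proof.
move=> hF; have [F0 F1] := field01 hF; split.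
  by apply/mxOverP => i l; rewrite mxE; case: andP.
rewrite /enorm (bigD1 j) //= big1 ?mxE ?eqxx => [|i ij].
  by rewrite normc1 expr1n addr0 sqrtr1.
by rewrite mxE (negPf ij) normc0 expr0n.
Qed.

Lemma max_normP (n : nat) (F : {pred R[i]}) (M : 'M[R[i]]_n.+1) :
  F = Num.real \/ F = predT ->
  exists b, [/\ unit_vectors F b, max_norm F M = enorm (M *m b) &
    forall b', unit_vectors F b' -> enorm (M *m b') <= max_norm F M].
Proof.
move=> hF.
pose D := [set w : 'rV[R]_(n.+1 + n.+1) | unit_vectors F (emb w)].
have cD : compact D.
  apply: bounded_closed_compact.
    apply: (@bounded_rV _ _ 1) => w [_ w1]; apply: emb_bound => j.
    by rewrite -w1; exact: normc_le_enorm.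
  apply: closedI; first exact: closed_over.
  apply: (@preimage_closed _ _ (fun w => enorm (emb w)) [set x : R | x = 1]).
    by move=> w _; apply: enorm_cont => *; exact: embP.
  exact: closed_eq.
have D0 : D !=set0.
  have [w we] := emb_surj (delta_mx 0 0 : 'cV[C]_n.+1).
  by exists w; rewrite /D /= we; exact: delta_unit.
have [|w] := @compact_EVT_max _ R (fun w => enorm (M *m emb w)) D D0 cD.
  apply: continuous_subspaceT; apply: enorm_cont => a u v.
  by rewrite embP mulmxDr -scalemxAr.
rewrite inE => Dw wmax.
have ub b : unit_vectors F b -> enorm (M *m b) <= enorm (M *m emb w).
  by have [u <-] := emb_surj b => Du; apply: wmax; rewrite inE.
have mE : max_norm F M = enorm (M *m emb w).
  apply/eqP; rewrite eq_le; apply/andP; split.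
    apply: ge_sup; first by exists (enorm (M *m emb w)), (emb w).
    by move=> _ [b Fb <-]; exact: ub.
  apply: ub_le_sup; last by exists (emb w).
  by exists (enorm (M *m emb w)) => _ [b Fb <-]; exact: ub.
by exists (emb w); split=> // b Fb; rewrite mE; exact: ub.
Qed.

Lemma phiP (n k : nat) (K F : {pred R[i]}) (A : 'M[R]_n.+1) :
  K = Num.real \/ K = predT -> F = Num.real \/ F = predT ->
  (k < degree_mxminpoly A)%N ->
  let g p := max_norm F (horner_mx (map_mx (real_complex R) A) p) in
  exists p, [/\ normalized_polys K k p, phi k K F A = g p &
    forall q, normalized_polys K k q -> phi k K F A <= g q].
Proof.
move=> hK hF kd g.
set AC := map_mx _ A in g *.
pose B := powers_mx AC k.+1.
have freeB : row_free B.
  rewrite /row_free eqn_leq rank_leq_row ltnNge; apply/negP => rB.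
  move: kd; rewrite -(degree_mxminpoly_map (real_complex R)) -/AC.
  rewrite /degree_mxminpoly; case: ex_minnP => d _ /(_ k rB).
  by rewrite leqNgt => /negP.
pose P (w : 'rV[R]_(k.+1 + k.+1)) := rVpoly (emb w)^T.
have P_coef w (j : 'I_k.+1) : (P w)`_j = emb w j 0.
  by rewrite coef_rVpoly_ord mxE.
have P_surj (p : {poly C}) : (size p <= k.+1)%N -> exists w, P w = p.
  move=> sp; have [w we] := emb_surj (poly_rV p : 'rV[C]_k.+1)^T.
  by exists w; rewrite /P we trmxK poly_rV_K.
have normP w : normalized_polys K k (P w) <->
    emb w \is a mxOver K /\ emb w 0 0 = 1.
  split=> [[PK _ P0]|[wK w0]].
    split; last by rewrite -P_coef -[(P w)`_ _]horner_coef0.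
    by apply/mxOverP => i j; rewrite ord1 -P_coef; exact: (polyOverE _ hK).1.
  split; last 2 first.
  - exact: size_poly.
  - by rewrite horner_coef0 -w0 -P_coef.
  apply/(polyOverE _ hK) => i; rewrite /P coef_rVpoly; case: insubP => [j _ _|_].
    by rewrite mxE; exact: (mxOverP wK).
  by case: (field01 hK).
have g_ge (q : {poly C}) b : unit_vectors F b -> enorm (horner_mx AC q *m b) <= g q.
  by move=> Fb; have [? [_ _]] := @max_normP n F (horner_mx AC q) hF; exact.
have gE (q : {poly C}) r : g q <= r <->
    (forall b, unit_vectors F b -> enorm (horner_mx AC q *m b) <= r).
  split=> [qr b Fb|]; first exact: le_trans (g_ge q b Fb) qr.
  by have [b [Fb gb _]] := @max_normP n F (horner_mx AC q) hF; rewrite /g gb; exact.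
have hcont b : continuous (fun w => enorm (horner_mx AC (P w) *m b)).
  apply: enorm_cont => a u v.
  by rewrite /P embP !linearD !linearZ /= mulmxDl -scalemxAl.
have [|w0 w0E] := P_surj 1; first by rewrite size_poly1.
have norm1 : normalized_polys K k (P w0).
  rewrite w0E; split; rewrite ?size_poly1 ?hornerC //.
  apply/(polyOverE _ hK) => i; rewrite coef1.
  by case: (field01 hK) => ? ?; case: (i == 0%N).
pose D := [set w | normalized_polys K k (P w) /\ g (P w) <= g (P w0)].
pose S := \sum_(i < n.+1) \sum_(l < n.+1) \sum_(j < k.+1)
  normc (pinvmx B (mxvec_index i l) j).
have S_ge i l j : normc (pinvmx B (mxvec_index i l) j) <= S.
  rewrite /S (bigD1 i) //= (bigD1 l) //= (bigD1 j) //= -!addrA lerDl.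
  by rewrite !addr_ge0 ?sumr_ge0 // => *; rewrite ?sumr_ge0 // => *;
    rewrite ?sumr_ge0.
have cD : compact D.
  apply: bounded_closed_compact.
    apply: (@bounded_rV _ _ (\sum_(t < (n.+1 * n.+1)%N) g (P w0) * S)).
    move=> w [_ gw]; apply: emb_bound => j.
    have -> : emb w j 0 = (mxvec (horner_mx AC (P w)) *m pinvmx B) 0 j.
      by rewrite horner_rVpoly vec_mxK mulmxKp // [RHS]mxE.
    rewrite mxE; apply: (@le_trans _ _ (\sum_t normc
        (mxvec (horner_mx AC (P w)) 0 t * pinvmx B t j))).
      elim/big_rec2: _ => [|t y z _ yz]; first by rewrite normc0.
      by apply: le_trans (le_normcD _ _) _; rewrite lerD2l.
    apply: ler_sum => t _; rewrite normcM.
    case/mxvec_indexP: t => i l; rewrite mxvecE; apply: ler_pM => //.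
    apply: le_trans gw; apply: le_trans (g_ge _ _ (delta_unit l hF)).
    by apply: le_trans (normc_le_enorm _ i); rewrite -colE mxE.
  rewrite (_ : D = [set w | emb w \is a mxOver K] `&`
     ((fun w : 'rV[R]_(k.+1 + k.+1) => w 0 (lshift _ 0)) @^-1` [set x : R | x = 1] `&`
     (fun w : 'rV[R]_(k.+1 + k.+1) => w 0 (rshift _ 0)) @^-1` [set x : R | x = 0]) `&`
     \bigcap_(b in @unit_vectors R F n.+1)
       (fun w => enorm (horner_mx AC (P w) *m b)) @^-1` [set x : R | x <= g (P w0)]).
    apply: closedI; first apply: closedI.
    - exact: closed_over.
    - apply: closedI; (apply: preimage_closed; last exact: closed_eq);
        by move=> ? _; exact: coord_continuous.
    apply: closed_bigI => b _; apply: preimage_closed; last exact: closed_le.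
    by move=> ? _; exact: hcont.
  have e1 w : emb w 0 0 = 1 <-> w 0 (lshift _ 0) = 1 /\ w 0 (rshift _ 0) = 0.
    by rewrite mxE; split=> [[-> ->]|[-> ->]].
  apply/seteqP; split=> w.
    by move=> [/normP[wK /e1 w1] /gE gw]; do 2!split=> //; split.
  by move=> [[wK w1] gw]; split; [apply/normP; split=> //; exact/e1|exact/gE].
have [w [nw gw] wmin] := compact_argmin cD (ex_intro _ w0 (conj norm1 (lexx _)))
  (fun b _ => hcont b) (fun w r _ => gE (P w) r).
have lb (q : {poly C}) : normalized_polys K k q -> g (P w) <= g q.
  move=> nq; have sq : (size q <= k.+1)%N by case: nq.
  have [u uE] := P_surj q sq; move: nq; rewrite -{}uE => nq.
  have /orP[qw0|qw0] := le_total (g (P u)) (g (P w0)).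
    exact: wmin u (conj nq qw0).
  exact: le_trans gw qw0.
have phiE : phi k K F A = g (P w).
  apply/eqP; rewrite eq_le; apply/andP; split.
    apply: ge_inf; last by exists (P w).
    by exists (g (P w)) => _ [q nq <-]; exact: lb.
  apply: lb_le_inf; first by exists (g (P w)), (P w).
  by move=> _ [q nq <-]; exact: lb.
exists (P w); split; [exact: nw|exact: phiE|] => q nq.
by rewrite phiE; exact: lb.
Qed.

End attainment.

(* Main.v *)
Require Import Defs.
From HB Require Import structures.
From mathcomp Require Import all_boot all_order all_algebra.
From mathcomp Require Import all_classical all_reals all_analysis.
From mathcomp Require Import complex.

Set Implicit Arguments.
Unset Strict Implicit.
Unset Printing Implicit Defensive.

Import Order.TTheory GRing.Theory Num.Theory.

Local Open Scope ring_scope.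

(** The four quantities lie in a cycle of inequalities
      phi(R,R) <= phi(C,R) <= phi(C,C) <= phi(R,C) <= phi(R,R),
    where the first argument is the field of coefficients of the polynomials
    and the second the field of entries of the vectors.  The two middle ones
    hold because a maximum grows with the set of vectors and a minimum shrinks
    as the set of polynomials grows.  The other two rest on the Pythagorean
    identity |x + i y|^2 = |x|^2 + |y|^2 for real vectors x and y
    ([enorm_cartesian]):

    - Write a normalized complex polynomial as p = r + i s with r and s real;
      then r(0) = 1, and |p(A) b|^2 = |r(A) b|^2 + |s(A) b|^2 for real b, so
      that r does at least as well as p on real vectors
      ([max_norm_re_poly_le]).

    - For real p the matrix M = p(A) is real, and
      |M (x + i y)|^2 = |M x|^2 + |M y|^2 <= mu^2 (|x|^2 + |y|^2), where mu is
      the maximum over the real unit vectors; so complex vectors do not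
      increase the maximum ([max_norm_real_mx_le]). *)

Section real_and_complex.
Variable R : realType.
Local Notation C := R[i].
Local Notation toC := (real_complex R).
Local Notation "M ^f" := (map_mx toC M).
Local Notation R_or_C F := (@eq {pred C} F Num.real \/ @eq {pred C} F predT).

Lemma enorm_ge0 n (v : 'cV[C]_n) : 0 <= enorm v.
Proof. exact: sqrtr_ge0. Qed.

Lemma enorm_sqr n (v : 'cV[C]_n) :
  enorm v ^+ 2 = \sum_i (complex.Re (v i 0) ^+ 2 + complex.Im (v i 0) ^+ 2).
Proof.
rewrite sqr_sqrtr; last by apply: sumr_ge0 => i _; exact: sqr_ge0.
apply: eq_bigr => i _; case: (v i 0) => a b /=.
by rewrite sqr_sqrtr // addr_ge0 ?sqr_ge0.
Qed.

(** Entrywise this is |a + i b|^2 = a^2 + b^2 for real a and b. *)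
Lemma enorm_cartesian n (x y : 'cV[R]_n) :
  enorm (x^f + 'i%C *: y^f) ^+ 2 = enorm x^f ^+ 2 + enorm y^f ^+ 2.
Proof.
rewrite !enorm_sqr -big_split; apply: eq_bigr => i _; rewrite !mxE /=.
by rewrite !mul0r !mul1r expr0n /= !(add0r, addr0, subr0, oppr0).
Qed.

Lemma enormZ n (t : R) (v : 'cV[C]_n) : 0 <= t ->
  enorm ((toC t) *: v) = t * enorm v.
Proof.
move=> t0; apply/eqP; rewrite -(@eqrXn2 _ 2) ?mulr_ge0 ?enorm_ge0 //.
rewrite exprMn !enorm_sqr mulr_sumr; apply/eqP/eq_bigr => i _.
by rewrite mxE; case: (v i 0) => a b /=; rewrite !mul0r subr0 addr0 !exprMn mulrDr.
Qed.

Lemma enorm0 n : enorm (0 : 'cV[C]_n) = 0.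
Proof. by rewrite -(scale0r 0) -(rmorph0 toC) enormZ ?mul0r. Qed.

Lemma enorm_eq0 n (v : 'cV[C]_n) : enorm v = 0 -> v = 0.
Proof.
move/(congr1 (fun t => t ^+ 2)); rewrite enorm_sqr expr0n /= => /eqP.
rewrite psumr_eq0 => [/allP v0|i _]; last by rewrite addr_ge0 ?sqr_ge0.
apply/colP => i; have := v0 i (mem_index_enum i); rewrite mxE.
case: (v i 0) => a b /=; rewrite paddr_eq0 ?sqr_ge0 // !sqrf_eq0.
by case/andP=> /eqP -> /eqP ->.
Qed.

Lemma real_cV n (b : 'cV[C]_n) : b \is a mxOver Num.real ->
  exists x : 'cV[R]_n, b = x^f.
Proof.
move=> /mxOverP br; exists (map_mx (@complex.Re R) b).
by apply/matrixP => i j; rewrite !mxE RRe_real.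
Qed.

Lemma mxOver_real m n (x : 'M[R]_(m, n)) : x^f \is a mxOver Num.real.
Proof. by apply/mxOverP => i j; rewrite mxE; apply/complex_realP; exists (x i j). Qed.

Lemma cartesian_cV n (b : 'cV[C]_n) :
  exists x y : 'cV[R]_n, b = x^f + 'i%C *: y^f.
Proof.
exists (map_mx (@complex.Re R) b), (map_mx (@complex.Im R) b).
by apply/matrixP => i j; rewrite !mxE -complexE.
Qed.

Lemma cartesian_poly (p : {poly C}) : exists r s : {poly R},
  [/\ p = map_poly toC r + 'i%C *: map_poly toC s & (size r <= size p)%N].
Proof.
exists (map_poly (@complex.Re R) p), (map_poly (@complex.Im R) p).
split; last exact: size_poly.
by apply/polyP => j; rewrite coefD coefZ !coef_map /= -complexE.
Qed.

Lemma le_max_norm n (F : {pred C}) (M : 'M[C]_n.+1) b : R_or_C F ->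
  unit_vectors F b -> enorm (M *m b) <= max_norm F M.
Proof. by move=> hF; have [? [_ _]] := max_normP M hF; exact. Qed.

Lemma max_norm_le n (F : {pred C}) (M : 'M[C]_n.+1) r : R_or_C F ->
  (forall b, unit_vectors F b -> enorm (M *m b) <= r) -> max_norm F M <= r.
Proof. by move=> hF; have [b [Fb -> _]] := max_normP M hF; exact. Qed.

Lemma max_norm_sub n (M : 'M[C]_n.+1) : max_norm Num.real M <= max_norm predT M.
Proof.
apply: max_norm_le => [|b [_ b1]]; first by left.
by apply: le_max_norm; [right|split=> //; exact/mxOverP].
Qed.

(** Homogeneity extends the bound from real unit vectors to all real vectors,
    such as the real and imaginary parts of a complex unit vector, which need
    not have norm 1 and may vanish. *)
Lemma enorm_real_le n (M : 'M[C]_n.+1) (x : 'cV[R]_n.+1) :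
  enorm (M *m x^f) <= max_norm Num.real M * enorm x^f.
Proof.
have [/enorm_eq0 ->|x_neq0] := eqVneq (enorm x^f) 0.
  by rewrite mulmx0 enorm0 mulr0.
have x_gt0 : 0 < enorm x^f by rewrite lt0r x_neq0 enorm_ge0.
have t0 : 0 <= (enorm x^f)^-1 by rewrite invr_ge0 enorm_ge0.
rewrite -ler_pdivrMr // mulrC -enormZ // scalemxAr -map_mxZ.
apply: le_max_norm; first by left.
by split; [exact: mxOver_real|rewrite map_mxZ enormZ // mulVf].
Qed.

Lemma max_norm_real_ge0 n (M : 'M[C]_n.+1) : 0 <= max_norm Num.real M.
Proof.
have [|b [_ -> _]] := @max_normP R n Num.real M; first by left.
exact: enorm_ge0.
Qed.

(** A real matrix acts separately on the real and imaginary parts x and y of a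
    complex vector, so by [enorm_cartesian] its effect on the squared norm is
    the sum of its effects on x and y, each controlled by [enorm_real_le]. *)
Lemma max_norm_real_mx_le n (M : 'M[R]_n.+1) :
  max_norm predT M^f <= max_norm Num.real M^f.
Proof.
apply: max_norm_le => [|b [_ b1]]; first by right.
have [x [y bE]] := cartesian_cV b.
have mu0 := max_norm_real_ge0 M^f.
rewrite -(@ler_pXn2r _ 2) ?nnegrE ?enorm_ge0 //.
rewrite -[leRHS]mulr1 -(expr1n R 2) -b1 bE enorm_cartesian.
rewrite mulmxDr -scalemxAr -!map_mxM enorm_cartesian mulrDr -!exprMn !map_mxM.
by rewrite lerD // ler_pXn2r ?nnegrE ?mulr_ge0 ?enorm_ge0 ?enorm_real_le.
Qed.

(** On a real vector b the values r(A) b and s(A) b are real, hence they are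
    the real and imaginary parts of (r + i s)(A) b; dropping the second part
    can only lower the norm. *)
Lemma max_norm_re_poly_le n (A : 'M[R]_n.+1) (r s : {poly R}) :
  max_norm Num.real (horner_mx A^f (map_poly toC r)) <=
  max_norm Num.real
    (horner_mx A^f (map_poly toC r + 'i%C *: map_poly toC s)).
Proof.
apply: max_norm_le => [|b rb]; first by left.
have hR : R_or_C Num.real by left.
apply: le_trans (le_max_norm _ hR rb).
have [x ->] := real_cV rb.1.
rewrite -(@ler_pXn2r _ 2) ?nnegrE ?enorm_ge0 //.
rewrite linearD linearZ /= -!map_horner_mx mulmxDl -scalemxAl -!map_mxM.
by rewrite enorm_cartesian lerDl sqr_ge0.
Qed.

(** Comparing two minima only requires, for each competitor in the larger one,
    some competitor in the smaller one that is at least as good.  The bound on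
    k makes the minimum on the right attained ([phiP]), so there is an optimal
    p to which the hypothesis applies. *)
Lemma le_phi n k (K K' F F' : {pred C}) (A : 'M[R]_n.+1) :
  R_or_C K -> R_or_C K' -> R_or_C F -> R_or_C F' ->
  (k < degree_mxminpoly A)%N ->
  (forall p, normalized_polys K' k p -> exists2 q, normalized_polys K k q &
    max_norm F (horner_mx A^f q) <= max_norm F' (horner_mx A^f p)) ->
  phi k K F A <= phi k K' F' A.
Proof.
move=> hK hK' hF hF' kd improve.
have [p [np -> _]] := phiP hK' hF' kd.
have [q nq qp] := improve p np.
by have [_ [_ _ phi_le]] := phiP hK hF kd; apply: le_trans (phi_le q nq) qp.
Qed.

(** The real part of a polynomial is still normalized: p(0) is its constant
    coefficient, and the value 1 is real. *)
Lemma normalized_re_poly k (r s : {poly R}) (p : {poly C}) :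
  p = map_poly toC r + 'i%C *: map_poly toC s -> (size r <= size p)%N ->
  normalized_polys predT k p -> normalized_polys Num.real k (map_poly toC r).
Proof.
move=> pE rp [_ sp p0]; split.
- by apply/polyOverP => j; rewrite coef_map; apply/complex_realP; exists r`_j.
- by rewrite size_map_poly (leq_trans rp).
move: p0; rewrite pE hornerD hornerZ !horner_coef0 !coef_map /=.
by case; rewrite !mul0r !mul1r subr0 addr0 => ->.
Qed.

Lemma real_poly (p : {poly C}) : p \is a polyOver Num.real ->
  exists r : {poly R}, p = map_poly toC r.
Proof.
move=> /polyOverP pr; exists (map_poly (@complex.Re R) p).
by apply/polyP => j; rewrite !coef_map /= RRe_real.
Qed.

End real_and_complex.

Theorem theorem6p1 (R : realType) (n k : nat) (A : 'M[R]_n.+1)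
    (hA : A \in unitmx) (hk1 : (1 <= k)%N) (hkd : (k <= degree_mxminpoly A - 1)%N) :
  [/\ phi k Num.real Num.real A = phi k predT Num.real A,
      phi k predT Num.real A = phi k Num.real predT A
    & phi k Num.real predT A = phi k predT predT A].
Proof.
have kd : (k < degree_mxminpoly A)%N.
  by move: hkd; case: degree_mxminpoly => [|d]; rewrite ?subn1 //= leqn0; case: k hk1.
have hR : @eq {pred R[i]} Num.real Num.real \/ @eq {pred R[i]} Num.real predT.
  by left.
have hC : @eq {pred R[i]} predT Num.real \/ @eq {pred R[i]} predT predT.
  by right.
have RR_CR : phi k Num.real Num.real A <= phi k predT Num.real A.
  apply: le_phi => // p np; have [r [s [pE rp]]] := cartesian_poly p.
  exists (map_poly (real_complex R) r); first exact: normalized_re_poly pE rp np.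
  by rewrite pE; exact: max_norm_re_poly_le.
have CR_CC : phi k predT Num.real A <= phi k predT predT A.
  by apply: le_phi => // p np; exists p => //; exact: max_norm_sub.
have CC_RC : phi k predT predT A <= phi k Num.real predT A.
  by apply: le_phi => // p [_ sp p0]; exists p => //; split=> //; exact/allP.
have RC_RR : phi k Num.real predT A <= phi k Num.real Num.real A.
  apply: le_phi => // p np; exists p => //.
  have [r ->] := real_poly (let: And3 pK _ _ := np in pK).
  by rewrite -map_horner_mx; exact: max_norm_real_mx_le.
have CR_RC := le_trans CR_CC CC_RC; have RC_CR := le_trans RC_RR RR_CR.
split; apply/eqP; rewrite eq_le.
- by rewrite RR_CR (le_trans CR_RC RC_RR).
- by rewrite CR_RC RC_CR.
- by rewrite CC_RC (le_trans RC_CR CR_CC).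
Qed.
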